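(* Let $N\ge 2$, and consider $N$ unit-mass particles on $\mathbb{R}$ with coordinates $x_1,\dots,x_N$, evolving according to the Hamiltonian equations $\ddot x_k=-\partial U/\partial x_k$, $k=1,\dots,N$, with potential energy $$U=\sum_{1\le k<l\le N}\frac{\omega^2}{2}\,I(|x_k-x_l|),\qquad I\in\mathbf{I}\left(\tfrac1N,\tfrac rN\right),\quad \omega=\omega' N,$$ where $0<r<1$ and $\omega'>0$, and with initial conditions $$x_1(0)=0,\quad \dot x_1(0)=v,\quad x_{k+1}(0)-x_k(0)=\frac1N X\left(\frac kN\right),\quad \dot x_{k+1}(0)-\dot x_k(0)=\frac1N V\left(\frac kN\right),\quad k=1,\dots,N-1,$$ where $v\in\mathbb{R}$, $X,V\in C^4([0,1])$, $X>0$, $X(0)=X(1)=1$, $V(0)=V(1)=0$. Put $$\alpha=\int_0^1|X''(y)|\,dy,\qquad \beta=\int_0^1|V''(y)|\,dy,\qquad \gamma=2\alpha+\frac{\beta}{\omega'},$$ and assume $\gamma<\min\left(r,\frac{1-r}{2}\right)$. Assume that initially the system is in $\Omega_N(\gamma)$. Then it stays in $\Omega_N(\gamma)$ forever, that is, for every $t\ge 0$ and every $k=1,\dots,N-1$, $$\frac{1-\gamma}{N}\le x_{k+1}(t)-x_k(t)\le\frac{1+\gamma}{N}.$$ Consequently the particles never collide in the strong sense: $\inf_{t\ge0}\inf_{j\ne k}|x_j(t)-x_k(t)|>0$.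
   Context: For $0<a_1<a$, $\mathbf{I}(a,a_1)$ denotes the class of functions $I$ on $(0,\infty)$ such that: (1) $I(x)=(x-a)^2$ for $a-a_1<x<a+a_1$; (2) $I(x)$ is constant for $x\ge a+a_1$; (3) $I(x)$ is arbitrary for $0<x\le a-a_1$. $\Omega_N(\gamma)\subset\mathbb{R}^N$ is the set of $(x_1,\dots,x_N)$ such that $\frac{1-\gamma}{N}\le x_{k+1}-x_k\le\frac{1+\gamma}{N}$ for all $k=1,\dots,N-1$. *)

(* Defs.v *)
From mathcomp Require Import all_boot all_order all_algebra.
From mathcomp Require Import all_classical all_reals all_analysis.

Set Implicit Arguments.
Unset Strict Implicit.
Unset Printing Implicit Defensive.

Import Order.TTheory GRing.Theory Num.Theory.
Import numFieldNormedType.Exports.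

Local Open Scope classical_set_scope.
Local Open Scope ring_scope.

(* Derivatives relative to an interval D: the limits are taken inside D, so the
   derivatives at the endpoints of D are one-sided and the values of f outside
   D play no role. *)
Definition quotient_on (R : realType) (D : set R) (f : R -> R) (x : R) :
    set_system R :=
  (f y - f x) / (y - x) @[y --> within D x^'].

Definition derivable_on (R : realType) (D : set R) (f : R -> R) (x : R) : Prop :=
  cvg (quotient_on D f x).

Definition derive_on (R : realType) (D : set R) (f : R -> R) : R -> R :=
  fun x => lim (quotient_on D f x).

Definition derivn_on (R : realType) (D : set R) (n : nat) (f : R -> R) :
    R -> R :=
  iter n (derive_on D) f.

Definition Cn_on (R : realType) (n : nat) (D : set R) (f : R -> R) : Prop :=
  (forall j x, (j < n)%N -> D x -> derivable_on D (derivn_on D j f) x) /\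
  {within D, continuous (derivn_on D n f)}.

(* The class I(a, a1), for 0 < a1 < a. Its members are functions on (0, oo);
   they are represented by total functions whose values on (-oo, 0] are
   unconstrained, as are those on (0, a - a1]. Nothing is required of the
   constant, so I may be discontinuous at a + a1. *)
Definition classI (R : realType) (a a1 : R) (I : R -> R) : Prop :=
  (forall x, a - a1 < x < a + a1 -> I x = (x - a) ^+ 2) /\
  (exists c, forall x, a + a1 <= x -> I x = c).

(* Configurations are row vectors; the particle x_k, 1 <= k <= N, is the entry
   of index k - 1. *)
Definition potential (R : realType) (N : nat) (omega : R) (I : R -> R)
    (q : 'rV[R]_N) : R :=
  \sum_(k < N) \sum_(l < N | (k < l)%N)
    omega ^+ 2 / 2 * I `|q ord0 k - q ord0 l|.

Definition Omega (R : realType) (N : nat) (gamma : R) : set 'rV[R]_N :=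
  [set q | forall k l : 'I_N, l = k.+1 :> nat ->
     (1 - gamma) / N%:R <= q ord0 l - q ord0 k <= (1 + gamma) / N%:R].

Notation times := `[0, +oo[%classic (only parsing).

Definition coord (R : realType) (N : nat) (x : R -> 'rV[R]_N) (k : 'I_N) :
    R -> R :=
  fun t => x t ord0 k.

Definition velocity (R : realType) (N : nat) (x : R -> 'rV[R]_N) (k : 'I_N) :
    R -> R :=
  derive_on times (coord x k).

(* The differentiability of U at x t is part of being a motion, because U need
   not be differentiable everywhere. No absence of collisions is required. *)
Definition motion (R : realType) (N : nat) (U : 'rV[R]_N -> R)
    (x : R -> 'rV[R]_N) : Prop :=
  forall (t : R) (k : 'I_N), 0 <= t ->
    [/\ derivable_on times (coord x k) t,
        derivable_on times (velocity x k) t,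
        derivable U (x t) (delta_mx ord0 k) &
        derive_on times (velocity x k) t = - 'D_(delta_mx ord0 k) U (x t)].

(* The gap between the entries k and l = k + 1 is x_(l+1) - x_l in 1-based
   numbering, hence the sample point l / N. *)
Definition initial_data (R : realType) (N : nat) (v : R) (X V : R -> R)
    (x : R -> 'rV[R]_N) : Prop :=
  (forall k : 'I_N, k = 0%N :> nat -> coord x k 0 = 0 /\ velocity x k 0 = v) /\
  (forall k l : 'I_N, l = k.+1 :> nat ->
     coord x l 0 - coord x k 0 = N%:R^-1 * X (l%:R / N%:R) /\
     velocity x l 0 - velocity x k 0 = N%:R^-1 * V (l%:R / N%:R)).

(* Main.v *)
(* Let d_j be the deviation of the j-th spacing from 1/N, with d_0 = d_N = 0.  As
   long as the configuration is in Omega(g) for some g < min(r, (1 - r)/2), only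
   neighbours interact, and d obeys the discrete wave equation
   d_j'' = omega^2 (d_(j+1) - 2 d_j + d_(j-1)), which conserves
   E = sum_j (d_j')^2 + omega^2 sum_j (d_(j+1) - d_j)^2.  Since d vanishes at both
   ends, Cauchy-Schwarz gives 4 omega^2 d_j^2 <= N E.  Rolle's theorem applied to X
   and V makes X' at most alpha and |V| at most beta, so N E is initially at
   most (omega' alpha)^2 + beta^2 and |d_j| <= (alpha + beta / omega') / (2 N): a
   bound below gamma / N, which a continuity argument propagates to all times.
   Existence: the solution of the linear system, a power series in time, never
   leaves the region where the linear system is the true one. *)

Require Import Defs.
From mathcomp Require Import all_boot all_order all_algebra.
From mathcomp Require Import all_classical all_reals all_analysis.
From mathcomp Require Import ring lra.

Set Implicit Arguments.
Unset Strict Implicit.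
Unset Printing Implicit Defensive.

Import Order.TTheory GRing.Theory Num.Theory.
Import numFieldNormedType.Exports.

Local Open Scope classical_set_scope.
Local Open Scope ring_scope.

(** * Derivatives relative to a set *)

Lemma is_derive_quotient_on (R : realType) (D : set R) (f : R -> R) (x l : R) :
  is_derive x 1 f l -> quotient_on D f x --> l.
Proof.
move=> [fx <-].
have cx : (y - x) @[y --> within D x^'] --> (0 : R)^'.
  apply: cvg_trans (_ : (y - x) @[y --> x^'] `=>` _).
    by apply: cvg_app; exact: cvg_within.
  move=> P [/= e e0 eP]; exists e => //= y yx yneq.
  apply: eP; last by rewrite subr_eq0.
  by rewrite /= sub0r normrN distrC.
have := cvg_comp _ _ cx fx; apply: cvg_trans; apply: near_eq_cvg.
by near=> y; rewrite /= mulrC /GRing.scale /= mulr1 subrK.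
Unshelve. all: by end_near. Qed.

Lemma quotient_on_is_derive (R : realType) (D : set R) (f : R -> R) (x l : R) :
  nbhs x D -> quotient_on D f x --> l -> is_derive x 1 f l.
Proof.
move=> Dx fl.
have cx : (h + x) @[h --> (0 : R)^'] --> within D x^'.
  move=> P [/= e e0 eP]; case: Dx => d /= d0 dD.
  exists (Num.min e d); rewrite /= ?lt_min ?e0// => h.
  rewrite /= sub0r normrN lt_min => /andP[he hd] h0.
  apply: eP; first by rewrite /= opprD addrCA subrr addr0 normrN.
    by rewrite -subr_eq0 addrK.
  by apply: dD; rewrite /= opprD addrCA subrr addr0 normrN.
have : h^-1 *: (f (h *: (1 : R) + x) - f x) @[h --> (0 : R)^'] --> l.
  have := cvg_comp _ _ cx fl; apply: cvg_trans; apply: near_eq_cvg.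
  by near=> h; rewrite /= addrK mulrC /GRing.scale /= mulr1.
move=> H; split; first by apply/cvg_ex; exists l.
exact: cvg_lim.
Unshelve. all: by end_near. Qed.

Section derive_on_theory.
Variables (R : realType) (D : set R).
Implicit Types (f g : R -> R) (x l : R).

Lemma derivable_onP f x :
  derivable_on D f x -> quotient_on D f x --> derive_on D f x.
Proof. by []. Qed.

(** Properness gives uniqueness of limits, which pins down the value of [lim]; it holds as soon as
    [x] is not isolated in [D]. *)
Lemma quotient_on_derive_on f x l : ProperFilter (within D x^') ->
  quotient_on D f x --> l -> derivable_on D f x /\ derive_on D f x = l.
Proof.
move=> FD fl; split; first by apply/cvg_ex; exists l.
exact: cvg_lim.
Qed.

(** [velocity] is itself a relative derivative, known only on [times]; this allows replacing it
    there by an explicit function before differentiating again. *)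
Lemma eq_quotient_on f g x :
  {in D, f =1 g} -> D x -> quotient_on D f x = quotient_on D g x.
Proof.
move=> fg Dx.
have E : forall y, D y -> (f y - f x) / (y - x) = (g y - g x) / (y - x).
  by move=> y Dy; rewrite !fg ?inE.
apply/seteqP; split; apply: near_eq_cvg; apply: (@filterS _ (within D x^') _ D).
- by move=> y Dy /=; rewrite E.
- exact: withinT.
- by move=> y Dy /=; rewrite E.
- exact: withinT.
Qed.

Lemma derivable_on_continuous f x : derivable_on D f x ->
  f y @[y --> within D (nbhs x)] --> f x.
Proof.
move=> /derivable_onP; set l := derive_on D f x => fl.
suff : f y @[y --> within D x^'] --> f x.
  move=> H P fP; have /= {}H : nbhs x (fun y => y != x -> D y -> P (f y)) := H P fP.
  suff: nbhs x (fun y => D y -> P (f y)) by [].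
  apply: (@filterS _ (nbhs x) _ _ _ _ H) => y H' Dy.
  by have [->|yx] := eqVneq y x; [exact: nbhs_singleton|exact: H'].
have : (f y - f x) / (y - x) * (y - x) + f x @[y --> within D x^'] -->
    l * (x - x) + f x.
  apply: cvgD; last exact: cvg_cst.
  apply: cvgM => //; apply: cvgB; last exact: cvg_cst.
  move=> P xP; have {}xP : nbhs x (fun y => P y) := xP.
  suff: nbhs x (fun y => y != x -> D y -> P y) by [].
  by apply: (@filterS _ (nbhs x) _ _ _ _ xP) => y Py _ _.
rewrite subrr mulr0 add0r; apply: cvg_trans; apply: near_eq_cvg.
suff: nbhs x (fun y => y != x -> D y ->
    (f y - f x) / (y - x) * (y - x) + f x = f y) by [].
by apply: (@nearW _ (nbhs x)) => y yx _; rewrite divfK ?subrK // subr_eq0.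
Qed.

End derive_on_theory.

Lemma dnbhs_within_proper (R : realType) (D : set R) (x : R) :
  (forall e, 0 < e -> exists y, [/\ y != x, `|x - y| < e & D y]) ->
  ProperFilter (within D x^').
Proof.
move=> H; split; last exact: within_filter.
move=> -[e /= e0 eP]; have [y [yx xy Dy]] := H e e0.
exact: eP xy yx Dy.
Qed.

Lemma times_proper (R : realType) (t : R) : 0 <= t ->
  ProperFilter (within `[0, +oo[ t^').
Proof.
move=> t0; apply: dnbhs_within_proper => e e0; exists (t + e / 2).
split; [lra | | by rewrite /= in_itv/=; lra].
by rewrite opprD addNKr normrN gtr0_norm; lra.
Qed.

Lemma unit_proper (R : realType) (t : R) : 0 <= t <= 1 ->
  ProperFilter (within `[0, 1] t^').
Proof.
move=> /andP[t0 t1]; apply: dnbhs_within_proper => e e0.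
have m0 : 0 < Num.min (e / 2) (1 / 2) by rewrite lt_min; lra.
have me : Num.min (e / 2) (1 / 2) <= e / 2 by rewrite ge_min lexx.
have m1 : Num.min (e / 2) (1 / 2) <= 1 / 2 by rewrite ge_min lexx orbT.
(* The increment goes to the right from the left half of the interval and to the left from the right
   half, so it stays in $[0,1]$. *)
have [th|th] := lerP t (1 / 2).
  exists (t + Num.min (e / 2) (1 / 2)); split; first lra.
    by rewrite opprD addNKr normrN gtr0_norm; lra.
  by rewrite /= in_itv/=; lra.
exists (t - Num.min (e / 2) (1 / 2)); split; first lra.
  by rewrite opprB addrC subrK gtr0_norm; lra.
by rewrite /= in_itv/=; lra.
Qed.

Lemma derivable_on_within (R : realType) (D : set R) (f : R -> R) :
  (forall x, D x -> derivable_on D f x) -> {within D, continuous f}.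
Proof.
by move=> df; apply/subspace_continuousP => x Dx; exact/derivable_on_continuous/df.
Qed.

Lemma Cn_onS (R : realType) (D : set R) n (f : R -> R) :
  Cn_on n.+1 D f -> Cn_on n D f.
Proof.
move=> [df _]; split; first by move=> j x jn; apply: df; exact: ltnW.
by apply: derivable_on_within => x; exact: df.
Qed.

Lemma derivable_on_is_derive (R : realType) (D : set R) (f : R -> R) (x : R) :
  nbhs x D -> derivable_on D f x -> is_derive x 1 f (derive_on D f x).
Proof. by move=> xD /derivable_onP; exact: quotient_on_is_derive. Qed.

(** * Functions on the unit interval with integrable second derivative *)

Lemma nbhs_unit (R : realType) (x : R) : 0 < x < 1 -> nbhs x `[0, 1]%classic.
Proof.
move=> x01; apply: filterS (near_in_itvoo (_ : x \in `]0, 1[)); last by rewrite in_itv.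
by move=> y; rewrite /= !in_itv/= => /andP[/ltW-> /ltW->].
Qed.

(** The fundamental theorem of calculus writes the increment as an integral over $[a,b]$, and
    enlarging the interval can only increase the integral of the absolute value. The derivative is
    required only in the open interval, where relative derivatives are ordinary ones. *)
Lemma increment_le_integral (R : realType) (f F : R -> R) (a b c d : R) :
  c <= a -> a <= b -> b <= d ->
  {within `[c, d], continuous f} -> {within `[c, d], continuous F} ->
  (forall x, c < x < d -> is_derive x 1 F (f x)) ->
  `|F b - F a| <= \int[lebesgue_measure]_(y in `[c, d]) `|f y|.
Proof.
move=> ca; rewrite le_eqVlt => /predU1P[-> _ _ _ _|ab bd cf cF dF].
  by rewrite subrr normr0; apply: Rintegral_ge0.
have sub : `[a, b] `<=` `[c, d] by apply: subset_itv; rewrite bnd_simp.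
have cf' := continuous_subspaceW sub cf.
have [_ cFa cFb] := (continuous_within_itvP _ ab).1 (continuous_subspaceW sub cF).
have dFab x : x \in `]a, b[ -> is_derive x 1 F (f x).
  by rewrite in_itv/= => xab; apply: dF; lra.
have -> : F b - F a = \int[lebesgue_measure]_(x in `[a, b]) f x.
  rewrite /Rintegral (@continuous_FTC2 _ f F) //.
    by split=> // x /dFab [].
  by move=> x /dFab ?; rewrite derive1E derive_val.
apply: le_trans (le_normr_Rintegral _ _) _ => //.
  by apply: continuous_compact_integrable; first exact: segment_compact.
have iL : lebesgue_measure.-integrable `[c, d] (EFin \o (fun y => `|f y|)).
  apply: continuous_compact_integrable; first exact: segment_compact.
  apply/subspace_continuousP => x xcd; apply: cvg_norm.
  by move/subspace_continuousP : cf; exact.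
apply: fine_le; [apply: integrable_fin_num => //| exact: integrable_fin_num |].
  exact: integrableS iL.
by apply: ge0_subset_integral => //; case/integrableP: iL.
Qed.

Section chord.
Variables (R : realType) (f : R -> R).
Hypotheses (f_C2 : Cn_on 2 `[0, 1] f) (f01 : f 0 = f 1).

Local Notation f' := (derivn_on `[0, 1] 1 f).
Local Notation f'' := (derivn_on `[0, 1] 2 f).
Local Notation L := (\int[lebesgue_measure]_(y in `[0, 1]) `|f'' y|)%R.

Lemma le_derive_diff (a b : R) : 0 <= a -> a <= b -> b <= 1 ->
  `|f' b - f' a| <= L.
Proof.
move=> a0 ab b1; apply: increment_le_integral => //.
- exact: f_C2.2.
- exact: (Cn_onS f_C2).2.
- move=> x x01; apply: derivable_on_is_derive; first exact: nbhs_unit.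
  by apply: (f_C2.1 1%N) => //; rewrite /= in_itv/=; lra.
Qed.

(** Equal end values give, by Rolle's theorem, a zero [c] of the derivative, so its value at [a] is
    an increment between [a] and [c]. *)
Lemma norm_derive_le (a : R) : 0 <= a <= 1 -> `|f' a| <= L.
Proof.
move=> /andP[a0 a1].
have /= [c c01 dc] : exists2 c, c \in `]0, 1[%R & is_derive (c : R) 1 f 0.
  apply: Rolle => //; last exact: (Cn_onS (Cn_onS f_C2)).2.
  move=> x; rewrite in_itv/= => x01.
  have [] // := @derivable_on_is_derive _ `[0, 1]%classic f x (nbhs_unit x01) _.
  by apply: (f_C2.1 0%N) => //; rewrite /= in_itv/=; lra.
(* Rolle's theorem concerns the two-sided derivative; uniqueness of limits identifies it with the
   relative one. *)
have fc0 : f' c = 0.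
  rewrite in_itv/= in c01.
  apply: (quotient_on_derive_on _ (is_derive_quotient_on _ dc)).2.
  by apply: unit_proper; lra.
rewrite in_itv/= in c01.
have [ac|ca] := leP a c.
  have : `|f' c - f' a| <= L by apply: le_derive_diff; lra.
  by rewrite fc0 sub0r normrN.
have : `|f' a - f' c| <= L by apply: le_derive_diff; lra.
by rewrite fc0 subr0.
Qed.

(** Applied to [X], this controls the differences of consecutive initial gaps; applied to [V] from
    the point 0, the initial gaps of the velocities. *)
Lemma chord_le (a b : R) : 0 <= a -> a <= b -> b <= 1 ->
  `|f b - f a| <= L * (b - a).
Proof.
move=> a0 ab b1.
have sub : `[a, b] `<=` `[0, 1] by apply: subset_itv; rewrite bnd_simp.
have [||c cab ->] := @MVT_segment _ f f' a b ab.
- move=> x; rewrite in_itv/= => x01; apply: derivable_on_is_derive.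
    by apply: nbhs_unit; lra.
  by apply: (f_C2.1 0%N) => //; rewrite /= in_itv/=; lra.
- by apply: continuous_subspaceW sub _; exact: (Cn_onS (Cn_onS f_C2)).2.
rewrite in_itv/= in cab.
rewrite normrM (@ger0_norm _ (b - a)) ?subr_ge0// ler_wpM2r ?subr_ge0//.
by apply: norm_derive_le; lra.
Qed.
End chord.

(** * The discrete wave equation *)

Lemma is_derive_sqr (R : realType) (f : R -> R) (x df : R) :
  is_derive x 1 f df -> is_derive x 1 (fun t => f t ^+ 2) (2 * f x * df).
Proof.
move=> fx; have -> : (fun t => f t ^+ 2) = f ^+ 2.
  by apply/funext => t; rewrite exprfctE.
by apply: (is_derive_eq (is_deriveX 2 fx)); rewrite /GRing.scale /= expr1.
Qed.

Lemma is_derive_fsum (R : realType) (I : Type) (s : seq I) (P : pred I)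
    (h : I -> R -> R) (x : R) (dh : I -> R) :
  (forall i, P i -> is_derive x 1 (h i) (dh i)) ->
  is_derive x 1 (fun t => \sum_(i <- s | P i) h i t) (\sum_(i <- s | P i) dh i).
Proof.
move=> dhx; elim: s => [|i s IH].
  by under eq_fun do rewrite big_nil; rewrite big_nil; exact: is_derive_cst.
rewrite big_cons; under eq_fun do rewrite big_cons.
by case: ifPn => // /dhx hi; exact: is_deriveD.
Qed.

Lemma cvg_sqr (R : realType) (T : Type) (F : set_system T) {FF : Filter F}
    (f : T -> R) (l : R) :
  f @ F --> l -> (fun t => f t ^+ 2) @ F --> l ^+ 2.
Proof. by move=> fl; rewrite expr2; under eq_fun do rewrite expr2; exact: cvgM. Qed.

Section energy.
Variables (R : realType) (N : nat) (omega T : R) (q p : nat -> R -> R).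
Hypothesis T_gt0 : 0 < T.
Hypotheses (q0 : forall t, q 0 t = 0) (qN : forall t, q N t = 0).
Hypotheses (p0 : forall t, p 0 t = 0) (pN : forall t, p N t = 0).
Hypothesis q_cont : forall k, (k <= N)%N -> {within `[0, T], continuous (q k)}.
Hypothesis p_cont : forall k, (k <= N)%N -> {within `[0, T], continuous (p k)}.
Hypothesis dq : forall k (t : R), (k <= N)%N -> 0 < t < T -> is_derive t 1 (q k) (p k t).
Hypothesis dp : forall k (t : R), (0 < k < N)%N -> 0 < t < T -> is_derive t 1 (p k)
  (omega ^+ 2 * ((q k.+1 t - q k t) - (q k t - q k.-1 t))).

(* The energy of the wave equation for q, not the mechanical energy of the
   particles: the second sum is the sum of the squared forces, up to scaling. *)
Definition chain_energy t :=
  \sum_(k < N) (p k t) ^+ 2 + omega ^+ 2 * \sum_(k < N) (q k.+1 t - q k t) ^+ 2.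

(** In the derivative of [chain_energy], this makes the contributions of the two sums cancel. *)
Lemma summation_by_parts (a b : nat -> R) n : b 0%N = 0 -> b n = 0 ->
  \sum_(k < n) b k * ((a k) - (a k.-1)) =
  - \sum_(k < n) a k * (b k.+1 - b k).
Proof.
move=> b0; case: n => [|n]; first by rewrite !big_ord0 oppr0.
(* The induction carries the boundary term $a_m b_{m+1}$, which vanishes for the full sum. *)
suff : forall m, \sum_(k < m.+1) b k * (a k - a k.-1) =
  a m * b m.+1 - \sum_(k < m.+1) a k * (b k.+1 - b k).
  by move=> -> ->; rewrite mulr0 sub0r.
elim=> [|m IH]; first by rewrite !big_ord1 b0; ring.
by rewrite big_ord_recr IH [in RHS]big_ord_recr /=; ring.
Qed.

Lemma chain_energy_cst : chain_energy T = chain_energy 0.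
Proof.
pose a t k := q k.+1 t - q k t.
have [||c cT] := @MVT _ chain_energy (fun t =>
  \sum_(k < N) 2 * p k t * (omega ^+ 2 * (a t k - a t k.-1)) +
  omega ^+ 2 * \sum_(k < N) 2 * a t k * (p k.+1 t - p k t)) 0 T T_gt0.
- move=> t; rewrite in_itv/= => tT; apply: is_deriveD; last first.
    apply: is_deriveZ.
    apply: is_derive_fsum => k _; apply: is_derive_sqr; apply: is_deriveB.
      exact: dq (ltn_ord k) tT.
    exact: dq (ltnW (ltn_ord k)) tT.
  (* [dp] says nothing at index 0. There [p] is constantly 0 and, as [0.-1] is 0, the claimed
     derivative is 0 as well. *)
  apply: is_derive_fsum => -[[|k] kN] _; apply: is_derive_sqr => /=.
    have -> : p 0 = cst 0 by apply/funext => s; rewrite p0.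
    by apply: is_derive_eq (is_derive_cst _ _ _) _; rewrite subrr mulr0.
  exact: dp.
- apply/subspace_continuousP => t tT.
  have cq k : (k <= N)%N -> q k s @[s --> within `[0, T] (nbhs t)] --> q k t.
    by move=> /q_cont /subspace_continuousP; exact.
  have cp k : (k <= N)%N -> p k s @[s --> within `[0, T] (nbhs t)] --> p k t.
    by move=> /p_cont /subspace_continuousP; exact.
  apply: cvgD; [|apply: cvgM; [exact: cvg_cst|]].
    apply: cvg_big => [|k _]; first exact: add_continuous.
    exact: cvg_sqr (cp k (ltnW (ltn_ord k))).
  apply: cvg_big => [|k _]; first exact: add_continuous.
  exact: cvg_sqr (cvgB (cq k.+1 (ltn_ord k)) (cq k (ltnW (ltn_ord k)))).
have -> : \sum_(k < N) 2 * p k c * (omega ^+ 2 * (a c k - a c k.-1)) =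
    2 * omega ^+ 2 * \sum_(k < N) p k c * (a c k - a c k.-1).
  by rewrite mulr_sumr; apply: eq_bigr => k _; ring.
have -> : \sum_(k < N) 2 * a c k * (p k.+1 c - p k c) =
    2 * \sum_(k < N) a c k * (p k.+1 c - p k c).
  by rewrite mulr_sumr; apply: eq_bigr => k _; ring.
rewrite (@summation_by_parts (a c) (fun k => p k c)) // => /eqP.
rewrite (_ : _ * _ = 0) ?subr_eq0; first by move/eqP.
by ring.
Qed.

(** Cauchy-Schwarz against the constant 1, obtained by expanding the nonnegative sum of squared
    deviations from the mean [m]. *)
Lemma sqr_sum_le (F : nat -> R) n :
  (\sum_(i < n) F i) ^+ 2 <= n%:R * \sum_(i < n) F i ^+ 2.
Proof.
case: n => [|n]; first by rewrite !big_ord0 mulr0 expr0n.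
set S := \sum_(i < n.+1) F i; set Q := \sum_(i < _) _; pose m := S / n.+1%:R.
have n0 : n.+1%:R != 0 :> R by rewrite pnatr_eq0.
have : 0 <= \sum_(i < n.+1) (F i - m) ^+ 2 by apply: sumr_ge0 => i _; exact: sqr_ge0.
under eq_bigr do rewrite sqrrB.
rewrite big_split /= sumr_const card_ord sumrB sumrMnl -mulr_suml -/S -/Q.
have -> : Q - S * m *+ 2 + m ^+ 2 *+ n.+1 = (n.+1%:R * Q - S ^+ 2) / n.+1%:R.
  by rewrite /m -[in LHS]mulr_natr -[in X in _ - X]mulr_natr; field.
by rewrite pmulr_lge0 ?invr_gt0 ?ltr0n// subr_ge0.
Qed.

(** [q k] can be reached from either end, where [q] vanishes. The two estimates together use each
    increment once, so $2|q_k|$ is at most the sum of all absolute increments; squaring produces the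
    factor 4. *)
Lemma chain_energy_bound k t : (k <= N)%N ->
  4 * omega ^+ 2 * q k t ^+ 2 <= N%:R * chain_energy t.
Proof.
move=> kN; pose F i := `|q i.+1 t - q i t|.
have le m n : (m <= n)%N -> `|q n t - q m t| <= \sum_(m <= i < n) F i.
  by move=> mn; rewrite -(telescope_sumr (fun i => q i t))//; exact: ler_norm_sum.
have S0 : 0 <= \sum_(i < N) F i by apply: sumr_ge0 => i _; exact: normr_ge0.
have h2 : 2 * `|q k t| <= \sum_(i < N) F i.
  rewrite -(big_mkord xpredT F) (big_cat_nat _ kN)//= [2]/(1 + 1) mulrDl mul1r.
  apply: lerD; first by have := le _ _ (leq0n k); rewrite q0 subr0.
  by have := le _ _ kN; rewrite qN sub0r normrN.
have : (2 * `|q k t|) ^+ 2 <= N%:R * \sum_(i < N) F i ^+ 2.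
  by apply: le_trans (sqr_sum_le _ _); rewrite ler_sqr ?nnegrE// mulr_ge0.
rewrite exprMn real_normK ?num_real// => h.
have -> : 4 * omega ^+ 2 * q k t ^+ 2 = omega ^+ 2 * (2 ^+ 2 * q k t ^+ 2) by ring.
rewrite /chain_energy mulrDr; apply: ler_wpDl.
  by rewrite mulr_ge0// sumr_ge0// => i _; exact: sqr_ge0.
rewrite [leRHS]mulrCA ler_wpM2l ?sqr_ge0//; apply: le_trans h _.
by under eq_bigr do rewrite real_normK ?num_real//.
Qed.

End energy.

(** * Linear differential equations *)

Section ode.
Variables (R : realType).

(** Comparison with [C] times the exponential series at $|M||x|$. *)
Lemma is_cvg_pseries_factorial (u : nat -> R) (C M x : R) :
  (forall j, `|u j| <= C * M ^+ j) ->
  cvgn (pseries (fun j => u j / j`!%:R) x).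
Proof.
move=> uCM; apply: normed_cvg.
have C0 : 0 <= C by have := uCM 0%N; rewrite expr0 mulr1; exact: le_trans.
apply: (@series_le_cvg _ _ (fun j => C * exp_coeff (`|M| * `|x|) j)).
- by move=> j; exact: normr_ge0.
- by move=> j; rewrite mulr_ge0// /exp_coeff divr_ge0// exprn_ge0// mulr_ge0.
- move=> j; rewrite /exp_coeff /= normrM normf_div normrX exprMn normr_nat.
  rewrite mulrAC !mulrA ler_wpM2r ?invr_ge0// ler_wpM2r ?exprn_ge0//.
  apply: le_trans (uCM j) _; apply: ler_wpM2l => //.
  by rewrite -normrX ler_norm.
- exact: (is_cvg_seriesZ (is_cvg_series_exp_coeff _)).
Qed.

Lemma lim_pseries0 (a : nat -> R) : limn (pseries a 0) = a 0%N.
Proof.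
apply: cvg_lim => //; rewrite -cvg_shiftS.
rewrite (_ : (fun _ => _) = cst (a 0%N)); first exact: cvg_cst.
apply/funext => n; rewrite /pseries /series /= big_nat_recl// expr0 mulr1.
by rewrite big1 ?addr0// => i _; rewrite expr0n mulr0.
Qed.

Section first_order.
Variables (n : nat) (A : 'M[R]_n) (y0 : 'rV[R]_n).

(** [c j] is $y_0A^j$, and [a m k] lists the Taylor coefficients at 0 of the $m$-th derivative of
    component [k] of $y_0e^{tA}$. With this shift, termwise differentiation just raises [m]. *)
Let c j := iter j (mulmx^~ A) y0.
Let a m (k : 'I_n) j := c (j + m) ord0 k / j`!%:R.

Let c_le : exists C M : R, forall j k, `|c j ord0 k| <= C * M ^+ j.
Proof.
pose C : R := \sum_i `|y0 ord0 i|; pose M : R := \sum_i \sum_k `|A i k|; exists C, M.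
have C0 : 0 <= C by apply: sumr_ge0.
have M0 : 0 <= M by apply: sumr_ge0 => i _; apply: sumr_ge0.
elim=> [|j IH] k.
  by rewrite expr0 mulr1 /C (bigD1 k)//= lerDl sumr_ge0.
rewrite /c iterS mxE; apply: le_trans (ler_norm_sum _ _ _) _.
rewrite exprSr mulrA {2}/M mulr_sumr; apply: ler_sum => i _.
rewrite normrM; apply: ler_pM => //.
by rewrite (bigD1 k)//= lerDl sumr_ge0.
Qed.

Let a_cvg m k x : cvgn (pseries (a m k) x).
Proof.
have [C [M cCM]] := c_le.
apply: (@is_cvg_pseries_factorial (fun j => c (j + m) ord0 k) (C * M ^+ m) M).
by move=> j; apply: le_trans (cCM _ _) _; rewrite addnC exprD mulrA.
Qed.

Let a_diffs m k : pseries_diffs (a m k) = a m.+1 k.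
Proof.
apply/funext => j; rewrite /pseries_diffs /a factS natrM invfM addSnnS mulrCA.
by rewrite mulVKf ?pnatr_eq0.
Qed.

Lemma linear_ode : exists y : R -> 'rV[R]_n, y 0 = y0 /\
  forall (t : R) k, is_derive t 1 (fun s : R => y s ord0 k) ((y t *m A) ord0 k).
Proof.
exists (fun t => \row_k limn (pseries (a 0 k) t)); split.
  by apply/rowP => k; rewrite mxE lim_pseries0 /a /= fact0 divr1.
move=> t k; under eq_fun do rewrite mxE.
rewrite (_ : (_ *m _) _ _ = limn (pseries (pseries_diffs (a 0 k)) t)).
  (* Termwise differentiation at [t] needs a point of larger modulus where the series and its first
     two formal derivatives converge. *)
  apply: (@pseries_snd_diffs _ _ (`|t| + 1)); rewrite ?a_diffs //.
  by rewrite ltr_normr ltrDl ltr01.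
rewrite a_diffs mxE; apply/esym/cvg_lim => //.
rewrite (_ : pseries _ _ = fun m => \sum_i pseries (a 0 i) t m * A i k).
  apply: cvg_big => [|i _]; first exact: add_continuous.
  by apply: cvgM; [rewrite mxE; exact: a_cvg|exact: cvg_cst].
apply/funext => m; rewrite /pseries /series /=.
under [RHS]eq_bigr do rewrite mulr_suml.
rewrite exchange_big; apply: eq_bigr => j _; rewrite /a addn1 addn0 /c iterS mxE.
by rewrite !mulr_suml; apply: eq_bigr => i _; ring.
Qed.

End first_order.

(** Reduction to first order: the block matrix sends the pair $(u,w)$ to $(w,uA)$. *)
Lemma linear_ode2 n (A : 'M[R]_n) (u0 w0 : 'rV[R]_n) :
  exists u w : R -> 'rV[R]_n, [/\ u 0 = u0, w 0 = w0,
  forall (t : R) k, is_derive t 1 (fun s : R => u s ord0 k) (w t ord0 k) &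
  forall (t : R) k, is_derive t 1 (fun s : R => w s ord0 k) ((u t *m A) ord0 k)].
Proof.
have [y [y_0 dy]] := linear_ode (block_mx 0 A 1%:M 0) (row_mx u0 w0).
have yB t : y t *m block_mx 0 A 1%:M 0 =
    row_mx (rsubmx (y t)) (lsubmx (y t) *m A).
  by rewrite -{1}(hsubmxK (y t)) mul_row_block !mulmx0 mulmx1 add0r addr0.
exists (fun t => lsubmx (y t)), (fun t => rsubmx (y t)).
split; rewrite ?y_0 ?row_mxKl ?row_mxKr// => t k.
  have := dy t (lshift n k); rewrite yB row_mxEl.
  rewrite (_ : rsubmx _ _ _ = rsubmx (y t) ord0 k) //.
  by congr (is_derive _ _ _ _); apply/funext => s; rewrite mxE.
have := dy t (rshift n k); rewrite yB row_mxEr.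
by congr (is_derive _ _ _ _); apply/funext => s; rewrite mxE.
Qed.

End ode.

(** * The chain of particles *)

(* With c = 1/N and y the positions this is d_j, where the value 0 off the interior
   indices encodes the free ends; with c = 0 and y the velocities it is d_j'. *)
Definition gap (R : realType) (N : nat) (c : R) (y : nat -> R) (j : nat) : R :=
  if (0 < j < N)%N then y j - y j.-1 - c else 0.

(** Indexing by [nat] makes the neighbours [j.-1] and [j.+1] available without casts; the guard in
    [gap] keeps the default value of [inord] out of reach. *)
Definition pos (R : realType) (n : nat) (q : 'rV[R]_n.+1) (j : nat) : R :=
  q ord0 (inord j).

Lemma pos_ord (R : realType) n (q : 'rV[R]_n.+1) (k : 'I_n.+1) : pos q k = q ord0 k.
Proof. by rewrite /pos inord_val. Qed.

(** Consecutive spacings, each at least [c - g], add up. This separates non-neighbours in the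
    potential and later excludes collisions. *)
Lemma le_gap_dist (R : realType) (N : nat) (c g : R) (y : nat -> R) (k l : nat) :
  (forall j, (0 < j < N)%N -> `|gap N c y j| <= g) -> (k <= l < N)%N ->
  (l - k)%:R * (c - g) <= y l - y k.
Proof.
move=> gP /andP[kl lN]; rewrite -(subnKC kl) in lN *; rewrite addKn.
elim: (l - k)%N lN => [|d IH] dN; first by rewrite mul0r addn0 subrr.
have := gP (k + d.+1)%N; rewrite /gap dN addnS /= => /(_ isT).
rewrite addnS in dN; have {}IH := IH (ltnW dN).
rewrite ler_norml => /andP[h _]; rewrite -natr1 mulrDl mul1r; lra.
Qed.

Lemma is_derive_affine (R : realType) (a b x : R) :
  is_derive x 1 (fun h : R => a + h * b) b.
Proof.
have -> : (fun h : R => a + h * b) = cst a + b \*: id.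
  by apply/funext => h; rewrite /= mulrC.
apply: is_derive_eq (is_deriveD (is_derive_cst _ _ _) (is_deriveZ _ (is_derive_id _ _))) _.
by rewrite add0r /GRing.scale /= mulr1.
Qed.

(** Near [q] the potential is, up to a constant, quadratic in the gaps. Moving entry [m] stretches
    gap [m] and shrinks gap [m.+1] at unit rate; at an end particle the missing gap is 0, so the end
    is free. *)
Lemma is_derive_potential (R : realType) (n : nat) (omega r g : R) (I : R -> R)
    (q : 'rV[R]_n.+1) (m : 'I_n.+1) :
  let N := n.+1 in let a : R := N%:R^-1 in
  classI a (r / N%:R) I -> 0 <= g -> g < r -> g < (1 - r) / 2 ->
  (forall j, (0 < j < N)%N -> `|gap N a (pos q) j| <= g / N%:R) ->
  is_derive q (delta_mx ord0 m) (potential omega I)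
    (omega ^+ 2 * (gap N a (pos q) m - gap N a (pos q) m.+1)).
Proof.
move=> N a [I1 [c I2]] g0 g_r g_half gq.
rewrite -/a in I1 I2 gq.
have a0 : 0 < a by rewrite invr_gt0 ltr0n.
(* The rate of change of $x_l-x_k$ when entry [m] moves; it is at most 1 in absolute value for $k\ne
   l$. *)
pose e l k : R := (l == m)%:R - (k == m)%:R.
pose s j := gap N a (pos q) j.
(* U along the line q + h e_m for small h: neighbours stay within r/N of 1/N, and all
   other pairs are at distance at least 2 (1 - g)/N - |h| > (1 + r)/N. *)
pose psi (h : R) := \sum_(k < N) \sum_(l < N | (k < l)%N)
  omega ^+ 2 / 2 * (if l == k.+1 :> nat then (s l + h * e l k) ^+ 2 else c).
pose phi (h : R) := potential omega I (h *: delta_mx ord0 m + q).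
suff dphi : is_derive (0 : R) 1 phi (omega ^+ 2 * (s m - s m.+1)).
  have E : (fun h : R => h^-1 *: (phi (h *: (1 : R) + 0) - phi 0)) =
      (fun h : R => h^-1 *: (potential omega I (h *: delta_mx ord0 m + q) - potential omega I q)).
    by apply/funext => h; rewrite /phi scale0r add0r addr0 /GRing.scale /= mulr1.
  case: dphi; rewrite /derive /derivable E => dP dE.
  by split.
have near_psi : \forall h \near (0 : R), phi h = psi h.
  exists (Num.min ((r - g) * a) ((1 - r - 2 * g) * a)) => /=.
    by rewrite lt_min; apply/andP; split; (apply: mulr_gt0; last exact: a0);
      lra.
  move=> h; rewrite /= sub0r normrN lt_min => /andP[h1 h2].
  apply: eq_bigr => k _; apply: eq_bigr => l kl; congr (_ * _).
  rewrite !mxE !eqxx /= -!pos_ord.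
  have he : `|h * e l k| <= `|h|.
    rewrite normrM ler_piMr// /e; have [<-|_] := eqVneq l m.
      by rewrite -val_eqE /= ltn_eqF// subr0 normr1.
    by case: eqP => _; rewrite ?subrr ?sub0r ?normrN ?normr0 ?normr1.
  rewrite distrC (_ : _ - _ = pos q l - pos q k + h * e l k); last by rewrite /e; ring.
  set d := pos q l - pos q k + h * e l k.
  have h0 := normr_ge0 h.
  have ga := mulr_ge0 g0 (ltW a0).
  have ra : r * a < a by rewrite -[ltRHS]mul1r ltr_pM2r//; lra.
  move: h1 h2; rewrite !mulrBl mul1r => h1 h2.
  case: ifPn => [/eqP lk|lk].
    have sl : s l = pos q l - pos q k - a by rewrite /s /gap ltn_ord lk.
    have gl : `|s l| <= g * a by apply: gq; rewrite ltn_ord lk.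
    have dE : d - a = s l + h * e l k by rewrite sl /d; ring.
    move: gl he; rewrite !ler_norml => /andP[gl1 gl2] /andP[he1 he2].
    rewrite ger0_norm ?I1 ?dE//; first by apply/andP; split; lra.
    lra.
  have lk2 : (2 <= l - k)%N by rewrite ltn_subRL addn1 ltn_neqAle eq_sym lk.
  have := le_gap_dist gq (introT andP (conj (ltnW kl) (ltn_ord l))).
  have : 2 * (a - g * a) <= (l - k)%:R * (a - g * a).
    by rewrite ler_wpM2r ?ler_nat// subr_ge0; lra.
  move: he; rewrite ler_norml => /andP[he1 he2] d1 d2.
  have d3 : a + r * a <= d by rewrite /d; lra.
  by rewrite ger0_norm ?I2//; lra.
apply: (near_eq_is_derive (f := psi)).
  by apply: filterS near_psi => h ->.
pose ds (k l : 'I_N) : R := omega ^+ 2 / 2 *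
  (if l == k.+1 :> nat then 2 * (s l + 0 * e l k) * e l k else 0).
have : is_derive (0 : R) 1 psi (\sum_(k < N) \sum_(l < N | (k < l)%N) ds k l).
  apply: is_derive_fsum => k _; apply: is_derive_fsum => l _.
  apply: is_deriveZ; case: ifP => _; last exact: is_derive_cst.
  exact/is_derive_sqr/is_derive_affine.
move/is_derive_eq; apply.
(* Only $l=k+1$ contributes. The last [k] has no such [l], in agreement with the value 0 of
   [s N]. *)
have inner (k : 'I_N) : \sum_(l < N | (k < l)%N) ds k l =
    omega ^+ 2 * s k.+1 * ((k.+1 == m)%:R - (k == m)%:R).
  have [kN|kN] := ltnP k.+1 N.
    rewrite (bigD1 (Ordinal kN)) //= big1 => [|l /andP[_ lk]].
      by rewrite /ds eqxx /e -!val_eqE /=; field.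
    by rewrite /ds -[l == k.+1 :> nat]/(l == Ordinal kN) (negPf lk) mulr0.
  rewrite /s /gap [X in _ && X]ltnNge kN /= mulr0 mul0r big1// => l kl.
  by have := leq_trans (leq_ltn_trans kl (ltn_ord l)) kN; rewrite ltnn.
rewrite (eq_bigr _ (fun k _ => inner k)).
under eq_bigr do rewrite mulrBr.
rewrite sumrB mulrBr; congr (_ - _).
  (* The first sum selects $k=m-1$; for $m=0$ there is no such term, and [s 0] is 0. *)
  case: (posnP m) => [m0|m0].
    rewrite /s m0 /gap /= mulr0 big1// => k _; rewrite mulr0//.
  have mN : (m.-1 < N)%N by rewrite prednK// ltnW.
  rewrite (bigD1 (Ordinal mN))//= prednK// eqxx mulr1 big1 ?addr0// => k.
  rewrite -val_eqE /= => km; rewrite (_ : (k.+1 == m :> nat) = false) ?mulr0//.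
  by apply/negbTE; apply: contraNneq km => <-.
rewrite (bigD1 m)//= eqxx mulr1 big1 ?addr0// => k km.
by rewrite (negPf km) mulr0.
Qed.

Lemma is_derive_gap (R : realType) (N : nat) (c : R) (y dy : nat -> R -> R) (t : R) (j : nat) :
  (forall k, (k < N)%N -> is_derive t 1 (y k) (dy k t)) ->
  is_derive t 1 (fun s => gap N c (y^~ s) j) (gap N 0 (dy^~ t) j).
Proof.
move=> dyt; rewrite /gap; case: ifP => [/andP[j0 jN]|_]; last exact: is_derive_cst.
have dj := dyt j jN; have dj1 := dyt j.-1 (leq_ltn_trans (leq_pred j) jN).
exact: is_deriveB (is_deriveB dj dj1) (is_derive_cst c t 1).
Qed.

Lemma cvg_gap (R : realType) (F : set_system R) {FF : Filter F} (N : nat) (c : R)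
    (y : nat -> R -> R) (l : nat -> R) (j : nat) :
  (forall k, (k < N)%N -> y k @ F --> l k) ->
  gap N c (y^~ s) j @[s --> F] --> gap N c l j.
Proof.
move=> yl; rewrite /gap; case: ifP => [/andP[j0 jN]|_]; last exact: cvg_cst.
apply: cvgB; last exact: cvg_cst.
by apply: cvgB; apply: yl => //; apply: leq_ltn_trans jN; exact: leq_pred.
Qed.

(** * A bound on the gaps under the linear equations *)

Section chain_bound.
Variables (R : realType) (n : nat).
Local Notation N := n.+1.
Local Notation a := (N%:R^-1 : R).

(** Each of the [N] squared velocity gaps is of order $N^{-2}$, each squared gap difference of order
    $N^{-4}$. With frequency $\omega'N$ both sums are of order $1/N$, so the bound on [N] times the
    energy does not depend on [N]. *)
Lemma chain_energy_le (omega' alpha beta t : R) (q p : nat -> R -> R) :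
  0 <= alpha -> 0 <= beta ->
  (forall k, (k < N)%N -> `|q k.+1 t - q k t| <= alpha * a ^+ 2) ->
  (forall k, (k < N)%N -> `|p k t| <= beta * a) ->
  N%:R * chain_energy N (omega' * N%:R) q p t <= (omega' * alpha) ^+ 2 + beta ^+ 2.
Proof.
move=> alpha0 beta0 qa pb; rewrite /chain_energy.
have N0 : N%:R != 0 :> R by rewrite pnatr_eq0.
have a0 : 0 <= a by rewrite invr_ge0.
have le (F : 'I_N -> R) B : 0 <= B -> (forall k, `|F k| <= B) ->
    \sum_(k < N) F k ^+ 2 <= N%:R * B ^+ 2.
  move=> B0 FB; rewrite mulr_natl -[in leRHS](card_ord N) -sumr_const.
  apply: ler_sum => k _; rewrite -(real_normK (num_real (F k))).
  by rewrite ler_sqr ?nnegrE.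
have h1 : \sum_(k < N) p k t ^+ 2 <= N%:R * (beta * a) ^+ 2.
  by apply: le => [|k]; [exact: mulr_ge0|exact: pb].
have h2 : \sum_(k < N) (q k.+1 t - q k t) ^+ 2 <= N%:R * (alpha * a ^+ 2) ^+ 2.
  by apply: le => [|k]; [rewrite mulr_ge0// exprn_ge0|exact: qa].
apply: (@le_trans _ _ (N%:R * (N%:R * (beta * a) ^+ 2 +
    (omega' * N%:R) ^+ 2 * (N%:R * (alpha * a ^+ 2) ^+ 2)))).
  by rewrite ler_wpM2l// lerD// ler_wpM2l ?sqr_ge0.
rewrite [leLHS](_ : _ = (omega' * alpha) ^+ 2 + beta ^+ 2)//.
by move: N0; set d := N%:R => N0; field.
Qed.

(** Energy conservation carries the initial bound to time [T]. The form with scalar functions,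
    differentiable inside $(0,T)$ and continuous up to the ends, fits both a given motion, as long
    as its forces are linear, and the solution constructed for existence. *)
Lemma gap_bound (omega' alpha beta T : R) (X V : R -> R) (x v : nat -> R -> R) :
  0 < omega' -> 0 <= alpha -> 0 <= beta -> 0 <= T ->
  (forall b c : R, 0 <= b -> b <= c -> c <= 1 -> `|X c - X b| <= alpha * (c - b)) ->
  (forall b c : R, 0 <= b -> b <= c -> c <= 1 -> `|V c - V b| <= beta * (c - b)) ->
  X 0 = 1 -> X 1 = 1 -> V 0 = 0 ->
  (forall j, (0 < j < N)%N -> x j 0 - x j.-1 0 = a * X (j%:R / N%:R)) ->
  (forall j, (0 < j < N)%N -> v j 0 - v j.-1 0 = a * V (j%:R / N%:R)) ->
  (forall k, (k < N)%N -> {within `[0, T], continuous (x k)}) ->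
  (forall k, (k < N)%N -> {within `[0, T], continuous (v k)}) ->
  (forall k (t : R), (k < N)%N -> 0 < t < T -> is_derive t 1 (x k) (v k t)) ->
  (forall k (t : R), (k < N)%N -> 0 < t < T -> is_derive t 1 (v k)
     ((omega' * N%:R) ^+ 2 * (gap N a (x^~ t) k.+1 - gap N a (x^~ t) k))) ->
  forall j, `|gap N a (x^~ T) j| <= (2 * alpha + beta / omega') / N%:R.
Proof.
move=> om0 alpha0 beta0 T0 dX dV X0 X1 V0 x0 v0 cx cv dx dv j.
have N0 : 0 < N%:R :> R by rewrite ltr0n.
have a0 : 0 <= a by rewrite invr_ge0.
pose q k t := gap N a (x^~ t) k; pose p k t := gap N 0 (v^~ t) k.
have aN : a * N%:R = 1 by rewrite mulVf// pnatr_eq0.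
(* $X(0)=X(1)=1$ extends the sampling formula to the fictitious gaps 0 and [N], so the chord bound
   also covers the differences at the ends. *)
have q_0 k : (k <= N)%N -> q k 0 = a * (X (k%:R * a) - 1).
  rewrite /q /gap; case: (posnP k) => [->|k0 kN].
    by rewrite /= mul0r X0 subrr mulr0.
  move: kN; rewrite leq_eqVlt => /predU1P[->|kN].
    by rewrite ltnn andbF mulfV ?gt_eqF// X1 subrr mulr0.
  by rewrite kN x0 ?k0// mulrBr mulr1.
have p_0 k : (k < N)%N -> p k 0 = a * V (k%:R * a).
  rewrite /p /gap; case: (posnP k) => [->|k0 kN]; first by rewrite mul0r V0 mulr0.
  by rewrite /= kN v0 ?k0// subr0.
have ka k : (k <= N)%N -> 0 <= k%:R * a <= 1.
  by move=> kN; rewrite mulr_ge0//= ler_pdivrMr// mul1r ler_nat.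
have E0 : N%:R * chain_energy N (omega' * N%:R) q p 0 <=
    (omega' * alpha) ^+ 2 + beta ^+ 2.
  apply: chain_energy_le => // k kN.
    rewrite !q_0 ?(ltnW kN)// -mulrBr opprB addrA subrK normrM ger0_norm//.
    rewrite expr2 mulrCA ler_wpM2l//; apply: le_trans (dX _ _ _ _ _) _.
    + by case/andP: (ka _ (ltnW kN)).
    + by rewrite ler_wpM2r// ler_nat.
    + by case/andP: (ka _ kN).
    + by rewrite -mulrBl -natr1 addrAC subrr add0r mul1r.
  rewrite p_0// normrM ger0_norm// mulrC ler_wpM2r//.
  have /andP[k0 k1] := ka _ (ltnW kN).
  have := dV 0 (k%:R * a) (lexx _) k0 k1; rewrite V0 !subr0 => /le_trans; apply.
  by rewrite ler_piMr.
have ET : chain_energy N (omega' * N%:R) q p T = chain_energy N (omega' * N%:R) q p 0.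
  move: T0; rewrite le_eqVlt => /predU1P[<-//|T0].
  have gN0 c y : gap N c y N = 0 by rewrite /gap ltnn andbF.
  apply: chain_energy_cst => //.
  - by move=> t; exact: gN0.
  - move=> k _; apply/subspace_continuousP => t tT; apply: cvg_gap => i iN.
    by have /subspace_continuousP := cx i iN; exact.
  - move=> k _; apply/subspace_continuousP => t tT; apply: cvg_gap => i iN.
    by have /subspace_continuousP := cv i iN; exact.
  - by move=> k t _ tT; apply: is_derive_gap => i iN; exact: dx.
  - move=> k t kN tT; have /andP[k0 kn] := kN.
    apply: is_derive_eq.
      apply: (@is_derive_gap _ _ _ _ (fun i t => (omega' * N%:R) ^+ 2 *
        (gap N a (x^~ t) i.+1 - gap N a (x^~ t) i))) => i iN; exact: dv.
    by rewrite {1}/gap kN (prednK k0) subr0 -mulrBr.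
have [jN|Nj] := leqP j N; last first.
  rewrite /gap [X in _ && X]ltnNge (ltnW Nj) andbF normr0.
  by rewrite mulr_ge0// addr_ge0 ?mulr_ge0 ?invr_ge0 ?(ltW om0).
have qN t : q N t = 0 by rewrite /q /gap ltnn andbF.
have := chain_energy_bound (omega' * N%:R) p (fun t => erefl) qN T jN.
rewrite ET => /le_trans/(_ E0) h.
(* Adding the nonnegative cross term turns the sum of squares into a square. The resulting bound
   $(\alpha+\beta/\omega')/(2N)$ is well within the claim. *)
have {}h : (2 * omega' * N%:R * `|q j T|) ^+ 2 <= (omega' * alpha + beta) ^+ 2.
  rewrite exprMn real_normK ?num_real//.
  have := mulr_ge0 (mulr_ge0 (ltW om0) alpha0) beta0.
  by move: h; nra.
move: h; rewrite ler_sqr ?nnegrE ?mulr_ge0 ?addr_ge0 ?(ltW om0) ?mulr_ge0 ?(ltW om0)// => h.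
rewrite ler_pdivlMr// -(ler_pM2l om0) mulrDr [X in _ <= _ + X]mulrC divfK ?gt_eqF//.
have : 0 <= omega' * alpha by rewrite mulr_ge0// ltW.
by move: h; rewrite -/(q j T); nra.
Qed.
End chain_bound.

(** * Motions of the chain: continuity argument and existence *)

Section chain_motion.
Variables (R : realType) (n : nat) (r omega' v0 alpha beta g : R) (I X V : R -> R).
Local Notation N := n.+1.
Local Notation a := (N%:R^-1 : R).
Local Notation omega := (omega' * N%:R).
Local Notation gamma := (2 * alpha + beta / omega').
Hypotheses (omega'_gt0 : 0 < omega') (hI : classI a (r / N%:R) I).
Hypotheses (alpha_ge0 : 0 <= alpha) (beta_ge0 : 0 <= beta).
Hypothesis X_chord :
  forall b c : R, 0 <= b -> b <= c -> c <= 1 -> `|X c - X b| <= alpha * (c - b).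
Hypothesis V_chord :
  forall b c : R, 0 <= b -> b <= c -> c <= 1 -> `|V c - V b| <= beta * (c - b).
Hypotheses (X0 : X 0 = 1) (X1 : X 1 = 1) (V0 : V 0 = 0).
Hypotheses (g_ge0 : 0 <= g) (gamma_lt : gamma < g) (g_r : g < r) (g_half : g < (1 - r) / 2).

Lemma gamma_lt_div : gamma / N%:R < g / N%:R.
Proof. by rewrite ltr_pM2r// invr_gt0 ltr0n. Qed.

Section gap_bound_of_motion.
Variable x : R -> 'rV[R]_N.
Hypotheses (x_motion : motion (potential omega I) x) (x_init : initial_data v0 X V x).

Lemma initial_gap j : (0 < j < N)%N ->
  pos (x 0) j - pos (x 0) j.-1 = a * X (j%:R / N%:R) /\
  velocity x (inord j) 0 - velocity x (inord j.-1) 0 = a * V (j%:R / N%:R).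
Proof.
move=> /andP[j0 jN]; have [_ /(_ (inord j.-1) (inord j))] := x_init.
rewrite !inordK ?prednK//; last exact: ltnW.
by move=> /(_ erefl).
Qed.

(** The bootstrap step: gaps within $g/N$ before [T] make the forces linear, and [gap_bound] then
    yields a strictly smaller bound at [T] itself. For $T=0$ it is the bound on the initial data. *)
Lemma motion_gap_bound_until T : 0 <= T ->
  (forall t, 0 < t < T -> forall j, `|gap N a (pos (x t)) j| <= g / N%:R) ->
  forall j, `|gap N a (pos (x T)) j| <= gamma / N%:R.
Proof.
move=> T0 gT.
have sub : `[0, T] `<=` `[0, +oo[.
  by move=> t; rewrite /= !in_itv/= => /andP[->].
have int t : 0 < t < T -> nbhs t `[0, +oo[%classic.
  move=> /andP[t0 _]; exists t => //= s; rewrite /= in_itv/= andbT.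
  by rewrite ltr_norml => /andP[_]; rewrite ltrBlDr ltrDl => /ltW.
apply: (@gap_bound R n omega' alpha beta T X V (fun k t => pos (x t) k)
  (fun k => velocity x (inord k))) => //.
- by move=> j /initial_gap[h _]; exact: h.
- by move=> j /initial_gap[_ h]; exact: h.
- move=> k _; apply: continuous_subspaceW sub _; apply: derivable_on_within => t.
  by rewrite /= in_itv/= andbT => /(x_motion (inord k))[dx _ _ _]; exact: dx.
- move=> k _; apply: continuous_subspaceW sub _; apply: derivable_on_within => t.
  by rewrite /= in_itv/= andbT => /(x_motion (inord k))[_ dv _ _]; exact: dv.
- move=> k t _ tT; apply: derivable_on_is_derive (int t tT) _.
  by have [/ltW/(x_motion (inord k))[dx _ _ _] _] := andP tT; exact: dx.
- move=> k t kN tT; have [/ltW t0 _] := andP tT.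
  have [_ dv _ E] := x_motion (inord k) t0.
  apply: is_derive_eq (derivable_on_is_derive (int t tT) dv) _.
  have [_ dU] := is_derive_potential omega (inord k) hI g_ge0 g_r g_half
    (fun j _ => gT t tT j).
  by rewrite E dU inordK// -mulrN opprB.
Qed.

Lemma motion_gap_continuous (t : R) : 0 <= t -> forall j,
  gap N a (pos (x s)) j @[s --> within `[0, +oo[ (nbhs t)] --> gap N a (pos (x t)) j.
Proof.
move=> t0 j; apply: (@cvg_gap _ _ _ N a (fun k s => pos (x s) k)) => k _.
by apply: derivable_on_continuous; have [dx _ _ _] := x_motion (inord k) t0; exact: dx.
Qed.

Lemma motion_gap_bound (t : R) : 0 <= t ->
  forall j, `|gap N a (pos (x t)) j| <= gamma / N%:R.
Proof.
pose G t j := `|gap N a (pos (x t)) j|.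
move=> t0 j; rewrite leNgt; apply/negP => tj.
(* [S] collects the times up to which the gaps are within $g/N$. A violation of the sharper bound at
   [t] makes [t] an upper bound of [S]; at the supremum the sharper bound holds, and continuity
   leads beyond it. *)
pose S := [set T | 0 <= T /\ forall s, 0 < s < T -> forall i, G s i <= g / N%:R].
have S_ub T : S T -> T <= t.
  move=> [T0 ST]; rewrite leNgt; apply/negP => tT; move: tj; rewrite ltNge => /negP; apply.
  apply: motion_gap_bound_until => // s /andP[s0 st]; apply: ST.
  by rewrite s0 (lt_trans st).
have S0 : S 0 by split=> // s /andP[s0 /(lt_trans s0)]; rewrite ltxx.
have hS : has_sup S by split; [exists 0|exists t => ? /S_ub].
pose T := sup S; have T0 : 0 <= T by apply: ub_le_sup => //; case: hS.
have ST s : 0 < s < T -> forall i, G s i <= g / N%:R.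
  move=> /andP[s0 sT]; have := sT; rewrite -subr_gt0 => /sup_adherent/(_ hS)[T' [_ ST']].
  by rewrite subKr => sT'; apply: ST'; rewrite s0.
(* Only the gaps of index below [N] can be nonzero, so finitely many neighbourhoods are
   intersected. *)
have near_T : \forall s \near within `[0, +oo[ (nbhs T), forall i : 'I_N, G s i < g / N%:R.
  apply: filter_forall => i; apply: (cvgr_lt (`|gap N a (pos (x T)) i|)).
    by apply: cvg_norm; exact: motion_gap_continuous.
  by apply: le_lt_trans gamma_lt_div; exact: motion_gap_bound_until.
case: near_T => e /= e0 near_T.
suff : S (T + e / 2) by move=> /(sup_ubound hS.2); rewrite -/T; move: (e0) => ?; lra.
split=> [|s /andP[s0 sTe] i]; first by move: (e0) (T0) => ? ?; lra.
have [sT|Ts] := ltP s T; first by apply: ST; rewrite s0.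
have [iN|Ni] := ltnP i N; last first.
  rewrite /G /gap [X in _ && X]ltnNge Ni andbF normr0.
  by rewrite divr_ge0.
apply/ltW/(near_T s _ _ (Ordinal iN)); last by rewrite /= in_itv/= ltW.
by rewrite /= ler0_norm ?subr_le0//; move: (e0) => ?; lra.
Qed.

End gap_bound_of_motion.

Lemma sum_delta (u : 'rV[R]_N) j : (j < N)%N ->
  \sum_(i < N) u ord0 i * (j == i)%:R = pos u j.
Proof.
move=> jN; rewrite (bigD1 (inord j))//= inordK// eqxx mulr1 big1 ?addr0// => i.
by rewrite -val_eqE /= inordK// eq_sym => /negPf->; rewrite mulr0.
Qed.

(** With shift 0 the gap is linear in the configuration; expanding it on basis vectors lets the
    force be written as a matrix product. *)
Lemma gap_delta (u : 'rV[R]_N) j :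
  \sum_(i < N) u ord0 i * gap N 0 (fun l => (l == i)%:R) j = gap N 0 (pos u) j.
Proof.
rewrite /gap; case: ifP => [/andP[j0 jN]|_]; last by rewrite big1// => i _; rewrite mulr0.
under eq_bigr do rewrite subr0 mulrBr.
by rewrite sumrB !sum_delta ?subr0// (leq_ltn_trans (leq_pred j)).
Qed.

Lemma exists_motion :
  exists x : R -> 'rV[R]_N, motion (potential omega I) x /\ initial_data v0 X V x.
Proof.
(* [A] is the matrix of the linear force; [init] rebuilds positions or velocities from the first
   entry and the gaps by partial sums. *)
pose D (i : 'I_N) j : R := gap N 0 (fun l => (l == i)%:R) j.
pose A : 'M[R]_N := \matrix_(i, m) (omega ^+ 2 * (D i m.+1 - D i m)).
pose init (c : R) (F : nat -> R) : 'rV[R]_N := \row_m (c + \sum_(j < m) a * F j.+1).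
have [u [w [u0 w0 du dw]]] := linear_ode2 A
  (init 0 (fun j => X (j%:R / N%:R) - 1)) (init v0 (fun j => V (j%:R / N%:R))).
(* [u] is the displacement from the equally spaced lattice, which makes the linear system
   homogeneous. *)
pose x t : 'rV[R]_N := u t + \row_(m < N) (m%:R * a).
have uA t (m : 'I_N) : (u t *m A) ord0 m =
    omega ^+ 2 * (gap N 0 (pos (u t)) m.+1 - gap N 0 (pos (u t)) m).
  rewrite mxE -!gap_delta -sumrB mulr_sumr; apply: eq_bigr => i _.
  by rewrite !mxE /D; ring.
have gx t j : gap N a (pos (x t)) j = gap N 0 (pos (u t)) j.
  rewrite /gap; case: ifP => // /andP[j0 jN].
  rewrite /pos !mxE !inordK ?(leq_ltn_trans (leq_pred j))//.
  by rewrite -[in j%:R](prednK j0) -natr1; ring.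
have init_diff c F (k l : 'I_N) : l = k.+1 :> nat ->
    init c F ord0 l - init c F ord0 k = a * F l.
  by move=> lk; rewrite !mxE lk big_ord_recr /=; ring.
have dx (t : R) (k : 'I_N) : is_derive t 1 (Defs.coord x k) (w t ord0 k).
  have -> : Defs.coord x k = (fun s => u s ord0 k) + cst (k%:R * a).
    by apply/funext => s; rewrite /Defs.coord !mxE.
  by apply: is_derive_eq (is_deriveD (du t k) (is_derive_cst _ _ _)) _; rewrite addr0.
have vx (t : R) (k : 'I_N) : 0 <= t ->
    derivable_on `[0, +oo[ (Defs.coord x k) t /\ velocity x k t = w t ord0 k.
  by move=> /times_proper t0; apply: quotient_on_derive_on; exact: is_derive_quotient_on.
have qv (t : R) (k : 'I_N) : 0 <= t ->
    quotient_on `[0, +oo[ (velocity x k) t --> (u t *m A) ord0 k.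
  move=> t0; rewrite (@eq_quotient_on _ _ _ (fun s => w s ord0 k)).
  - exact: is_derive_quotient_on.
  - by move=> s; rewrite inE /= in_itv/= andbT => /(vx s k)[].
  - by rewrite /= in_itv/= andbT.
have x_init : initial_data v0 X V x.
  split=> [k k0|k l lk].
    have [_ ->] := vx 0 k (lexx _); rewrite w0 /Defs.coord !mxE u0 !mxE k0.
    by rewrite !big_ord0 mul0r !addr0.
  split.
    have x0 (m : 'I_N) : Defs.coord x m 0 = u 0 ord0 m + m%:R * a.
      by rewrite /Defs.coord !mxE.
    rewrite !x0 lk -natr1 [LHS](_ : _ = u 0 ord0 l - u 0 ord0 k + a); last by ring.
    by rewrite u0 init_diff// lk natr1; ring.
  have [_ ->] := vx 0 k (lexx _); have [_ ->] := vx 0 l (lexx _).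
  by rewrite w0 init_diff.
have gap_x (t : R) : 0 <= t -> forall j, `|gap N a (pos (x t)) j| <= gamma / N%:R.
  move=> t0.
  have cts (f : R -> R) (df : R -> R) : (forall s : R, is_derive s 1 f (df s)) ->
      {within `[0, t], continuous f}.
    move=> fd; apply: continuous_subspaceT => s.
    by apply: differentiable_continuous; apply/derivable1_diffP; case: (fd s).
  apply: (@gap_bound R n omega' alpha beta t X V (fun k t => pos (x t) k)
    (fun k t => w t ord0 (inord k))) => //.
  - by move=> j /(initial_gap x_init)[h _]; exact: h.
  - move=> j /andP[j0 jN].
    have jE : (inord j : 'I_N) = (inord j.-1 : 'I_N).+1 :> nat
      by rewrite (inordK jN) (inordK (leq_ltn_trans (leq_pred j) jN)) prednK.
    by rewrite w0 (init_diff _ _ _ _ jE) inordK.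
  - by move=> k _; apply: (cts _ (fun s => w s ord0 (inord k))) => s; exact: dx.
  - by move=> k _; apply: (cts _ (fun s => (u s *m A) ord0 (inord k))) => s; exact: dw.
  - by move=> k s kN _; apply: is_derive_eq (dw s _) _; rewrite uA !gx inordK.
exists x; split=> // t k t0.
have g_x j : (0 < j < N)%N -> `|gap N a (pos (x t)) j| <= g / N%:R.
  by move=> _; apply: le_trans (ltW gamma_lt_div); exact: gap_x.
have [dU DU] := is_derive_potential omega k hI g_ge0 g_r g_half g_x.
have [dv Dv] := quotient_on_derive_on (times_proper t0) (qv t k t0).
split=> //; first exact: (vx t k t0).1.
by rewrite Dv DU uA !gx -mulrN opprB.
Qed.
End chain_motion.

Theorem theorem1 (R : realType) (N : nat) (r omega' v : R) (I X V : R -> R)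
    (hN : (2 <= N)%N) (hr : 0 < r < 1) (homega' : 0 < omega')
    (hI : classI N%:R^-1 (r / N%:R) I)
    (hX : Cn_on 4 `[0, 1] X) (hV : Cn_on 4 `[0, 1] V)
    (X_gt0 : forall y, 0 <= y <= 1 -> 0 < X y)
    (X0 : X 0 = 1) (X1 : X 1 = 1) (V0 : V 0 = 0) (V1 : V 1 = 0) :
  let omega := omega' * N%:R in
  let U := @potential R N omega I in
  let alpha := (\int[lebesgue_measure]_(y in `[0, 1]) `|derivn_on `[0, 1] 2 X y|)%R in
  let beta := (\int[lebesgue_measure]_(y in `[0, 1]) `|derivn_on `[0, 1] 2 V y|)%R in
  let gamma := 2 * alpha + beta / omega' in
  gamma < Num.min r ((1 - r) / 2) ->
  (exists x : R -> 'rV[R]_N, motion U x /\ initial_data v X V x) /\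
  (forall x : R -> 'rV[R]_N,
     motion U x -> initial_data v X V x -> Omega gamma (x 0) ->
     (forall t, 0 <= t -> Omega gamma (x t)) /\
     0 < inf [set inf [set `|x t ord0 jk.1 - x t ord0 jk.2|
                      | jk in [set jk : 'I_N * 'I_N | jk.1 != jk.2]]
             | t in `[0, +oo[]).
Proof.
move=> omega U alpha beta gamma; rewrite lt_min => /andP[gamma_r gamma_half].
case: N hN => // n n_gt0 in hI omega U gamma gamma_r gamma_half *.
have alpha_ge0 : 0 <= alpha by exact: Rintegral_ge0.
have beta_ge0 : 0 <= beta by exact: Rintegral_ge0.
have gamma_ge0 : 0 <= gamma by rewrite addr_ge0 ?mulr_ge0 ?invr_ge0 ?(ltW homega').
(* The midpoint leaves room above [gamma] for the continuity argument and stays below both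
   thresholds. *)
pose g := (gamma + Num.min r ((1 - r) / 2)) / 2.
have [g1 g2 g3] : [/\ gamma < g, g < r & g < (1 - r) / 2].
  by rewrite /g minEle; case: ifPn; split; lra.
have X_chord := @chord_le R X (Cn_onS (Cn_onS hX)) (etrans X0 (esym X1)).
have V_chord := @chord_le R V (Cn_onS (Cn_onS hV)) (etrans V0 (esym V1)).
have g0 : 0 <= g := le_trans gamma_ge0 (ltW g1).
split.
  exact: (exists_motion v homega' hI alpha_ge0 beta_ge0 X_chord V_chord X0 X1 V0
    g0 g1 g2 g3).
move=> x x_motion x_init _.
have N_gt0 : 0 < n.+1%:R :> R by rewrite ltr0n.
have gap_x t : 0 <= t -> forall j, (0 < j < n.+1)%N ->
    `|gap n.+1 n.+1%:R^-1 (pos (x t)) j| <= gamma / n.+1%:R.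
  move=> t0 j _.
  exact: (motion_gap_bound homega' hI alpha_ge0 beta_ge0 X_chord V_chord X0 X1 V0
    g0 g1 g2 g3 x_motion x_init).
clearbody gamma; split=> [t t0 k l lk|].
  have := gap_x t t0 l; rewrite /gap ltn_ord lk /= -lk => /(_ isT).
  by rewrite lk /= -lk !pos_ord ler_distl mulrBl mulrDl mul1r.
have gap_gt0 : 0 < (1 - gamma) / n.+1%:R by apply: divr_gt0 => //; lra.
have far t (j k : 'I_n.+1) : 0 <= t -> (j < k)%N ->
    (1 - gamma) / n.+1%:R <= `|x t ord0 j - x t ord0 k|.
  move=> t0 jk; have := le_gap_dist (gap_x t t0) (introT andP (conj (ltnW jk) (ltn_ord k))).
  rewrite !pos_ord distrC => le_jk; apply: le_trans (ler_norm _); apply: le_trans le_jk.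
  rewrite mulrBl mul1r ler_peMl//; first by move: gap_gt0; rewrite mulrBl mul1r => /ltW.
  by rewrite ler1n subn_gt0.
apply: lt_le_trans gap_gt0 _; apply: lb_le_inf.
  by eexists; exists 0; rewrite //= in_itv/= lexx.
move=> _ [t + <-]; rewrite /= in_itv/= andbT => t0; apply: lb_le_inf.
  (* Here $N\ge2$ matters: the first and last particles are distinct, so the set of distances is
     nonempty, whereas the infimum of the empty set is 0 by convention. *)
  by eexists; exists (ord0, ord_max); rewrite //= -val_eqE /= eq_sym -lt0n.
move=> _ [[j k] /= jk <-]; have [jk'|kj|/val_inj jk'] := ltngtP j k.
- exact: far.
- by rewrite distrC; exact: far.
- by rewrite jk' eqxx in jk.
Qed.
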